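(* Fix $\mu>0$. For each $\lambda>0$ let $\rho^{\lambda}=\lambda/\mu$ and let $N^{\lambda}\geq 1$ be an integer (the number of servers in the system with arrival rate $\lambda$). Then $$\lim_{\lambda\to\infty} C\big(N^{\lambda},\rho^{\lambda}\big)=\begin{cases}\infty, & \text{if } 0<\rho^{\lambda}-N^{\lambda}\in\omega(\sqrt{\lambda}),\\[2pt] \big(1-\xi(z)\big)^{-1}\in(1,\infty), & \text{if } 0<\rho^{\lambda}-N^{\lambda}\in\Theta(\sqrt{\lambda}),\\[2pt] 1, & \text{if } |N^{\lambda}-\rho^{\lambda}|\in o(\sqrt{\lambda}),\\[2pt] \big(1-\xi(z)\big)^{-1}\in(0,1), & \text{if } 0<N^{\lambda}-\rho^{\lambda}\in\Theta(\sqrt{\lambda}),\\[2pt] 0, & \text{if } 0<N^{\lambda}-\rho^{\lambda}\in\omega(\sqrt{\lambda}),\end{cases}$$ where $z=\lim_{\lambda\to\infty}\frac{\rho^{\lambda}-N^{\lambda}}{\sqrt{N^{\lambda}}}\in\mathbb{R}$ when $|N^{\lambda}-\rho^{\lambda}|\in\Theta(\sqrt{\lambda})\cup o(\sqrt{\lambda})$.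
   Context: For an integer $N\geq 1$ and a real $\rho>0$, the Erlang-C formula is $$C(N,\rho)=\frac{\rho^N}{N!}\left(\left(1-\frac{\rho}{N}\right)\sum_{i=0}^{N-1}\frac{\rho^i}{i!}+\frac{\rho^N}{N!}\right)^{-1},$$ regarded as a mathematical expression (also when $\rho\geq N$). Asymptotic notation: for real-valued functions $f,g$ that are nonzero for all sufficiently large $x$, $f(x)\in o(g(x))$ (equivalently $g(x)\in\omega(f(x))$) means $\lim_{x\to\infty} f(x)/g(x)=0$, and $f(x)\in\Theta(g(x))$ means that $\lim_{x\to\infty}|f(x)/g(x)|$ exists and lies in $(0,\infty)$. A condition such as $0<\rho^\lambda-N^\lambda\in\omega(\sqrt\lambda)$ means that $\rho^\lambda-N^\lambda$ is positive and, as a function of $\lambda$, belongs to $\omega(\sqrt\lambda)$. The service rate $\mu$ is fixed as $\lambda\to\infty$; $N^\lambda$ may grow unboundedly or remain bounded. Let $\phi(x)=\frac{1}{\sqrt{2\pi}}e^{-x^2/2}$, $\Phi^c(x)=\int_x^\infty\phi(t)\,dt$, and $\xi(x)=x\,\frac{\Phi^c(x)}{\phi(x)}$ for $x\in\mathbb{R}$. *)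

(* Defs.v *)
From HB Require Import structures.
From mathcomp Require Import all_boot all_order all_algebra.
From mathcomp Require Import all_classical all_reals all_analysis.

Set Implicit Arguments.
Unset Strict Implicit.
Unset Printing Implicit Defensive.

Import Order.TTheory GRing.Theory Num.Theory.
Import numFieldNormedType.Exports.

Local Open Scope classical_set_scope.
Local Open Scope ring_scope.

(* For rho >= N this is no longer a probability, but the denominator is
   still positive for all N >= 1 and rho > 0, so the formula makes sense. *)
Definition erlangC (R : realType) (N : nat) (rho : R) : R :=
  rho ^+ N / N`!%:R *
  ((1 - rho / N%:R) * (\sum_(i < N) rho ^+ i / i`!%:R)
   + rho ^+ N / N`!%:R)^-1.

(* Asymptotic classes as x -> +oo, defined through limits of quotients and only
   for functions that are eventually nonzero.  They are thus narrower than the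
   relations =o, =Theta of the library, which are defined by inequalities (in
   particular, the quotient in [in_Theta] must converge). *)
Definition eventually_nonzero (R : realType) (f : R -> R) : Prop :=
  \forall x \near +oo, f x != 0.

Definition in_o (R : realType) (f g : R -> R) : Prop :=
  [/\ eventually_nonzero f, eventually_nonzero g
    & f x / g x @[x --> +oo] --> (0 : R)].

Definition in_omega (R : realType) (g f : R -> R) : Prop := in_o f g.

Definition in_Theta (R : realType) (f g : R -> R) : Prop :=
  [/\ eventually_nonzero f, eventually_nonzero g
    & exists2 c : R, 0 < c & `|f x / g x| @[x --> +oo] --> c].

(* Positivity for every lambda > 0 would be too much to ask of lambda / mu - N:
   it is negative for lambda < mu, because N >= 1. *)
Definition eventually_pos (R : realType) (f : R -> R) : Prop :=
  \forall x \near +oo, 0 < f x.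

Definition phi (R : realType) (x : R) : R :=
  (Num.sqrt (2 * pi))^-1 * expR (- x ^+ 2 / 2).

Definition Phic (R : realType) (x : R) : R :=
  \int[lebesgue_measure]_(t in `[x, +oo[) phi t.

Definition xi (R : realType) (x : R) : R := x * (Phic x / phi x).

(* Main.v *)
(* Write e = rho - N and W = \sum_(k <= N) N^_k / rho^k, the inverse of the
   Erlang-B formula.  Then C = 1/D with D = 1 - (e/N)(W - 1), and
   W_(N+1) = 1 + (N+1)/rho W_N.  Induction along this recursion gives
     rho / (4 (e^2 + rho)) <= D <= rho / (e^2 + rho)   for e > 0,
     1 + e^2 / N <= D                                  for e <= 0,
   which settles both omega-regimes and, passed to the limit, the strict
   inequalities for 1 - xi z; in particular no property of Phic beyond its
   definition is needed.
   When e / sqrt N --> z, the number W / sqrt N is the integral over [z, +oo[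
   of the step function equal to N^_k / rho^k on the k-th interval of length
   1 / sqrt N.  At distance u from z this function converges to
   exp (- z u - u^2 / 2) = phi (z + u) / phi z, under a Gaussian bound, so
   W / sqrt N --> Phic z / phi z by dominated convergence. *)
Require Import Defs.
From HB Require Import structures.
From mathcomp Require Import all_boot all_order all_algebra.
From mathcomp Require Import all_classical all_reals all_analysis.
From mathcomp Require Import measurable_realfun ring lra.

Set Implicit Arguments.
Unset Strict Implicit.
Unset Printing Implicit Defensive.

Import Order.TTheory GRing.Theory Num.Theory.
Import numFieldNormedType.Exports.

Local Open Scope classical_set_scope.
Local Open Scope ring_scope.

(** * The inverse Erlang-B formula: recursion and bounds *)

Definition erlangBinv (R : realType) (N : nat) (r : R) : R :=
  \sum_(k < N.+1) (N ^_ k)%:R / r ^+ k.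

Lemma erlangBinv0 (R : realType) (r : R) : erlangBinv 0 r = 1.
Proof. by rewrite /erlangBinv big_ord1 ffactn0 expr0 divr1. Qed.

Lemma erlangBinvS (R : realType) (N : nat) (r : R) : 0 < r ->
  erlangBinv N.+1 r = 1 + N.+1%:R / r * erlangBinv N r.
Proof.
move=> r0; rewrite /erlangBinv big_ord_recl ffactn0 expr0 divr1; congr +%R.
rewrite mulr_sumr; apply: eq_bigr => k _; rewrite /= /bump leq0n add1n ffactSS natrM exprS.
by field; rewrite ?expf_neq0 ?gt_eqF.
Qed.

(** Reversing the sum by [i = N - k] turns [r ^+ i / i!] into [r ^+ N / N!] times [N ^_ k / r ^+ k]
    with [1 <= k <= N]; the missing term [k = 0] accounts for the [- 1]. *)
Lemma sum_exp_erlangBinv (R : realType) (N : nat) (r : R) : 0 < r ->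
  \sum_(i < N) r ^+ i / i`!%:R = r ^+ N / N`!%:R * (erlangBinv N r - 1).
Proof.
move=> r0; elim: N => [|N IH]; first by rewrite big_ord0 erlangBinv0 subrr mulr0.
rewrite big_ord_recr /= IH erlangBinvS // factS natrM exprS.
by field; rewrite ?pnatr_eq0 -?lt0n ?fact_gt0 ?gt_eqF //= ltr0n.
Qed.

Lemma erlangCE (R : realType) (N : nat) (r : R) : 0 < r -> (0 < N)%N ->
  erlangC N r = (1 - (r - N%:R) / N%:R * (erlangBinv N r - 1))^-1.
Proof.
move=> r0 N0; rewrite /erlangC sum_exp_erlangBinv //.
have A0 : r ^+ N / N`!%:R != 0.
  by rewrite mulf_neq0 ?invr_eq0 ?expf_neq0 ?pnatr_eq0 -?lt0n ?fact_gt0 ?gt_eqF.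
have N1 : N%:R != 0 :> R by rewrite pnatr_eq0 -lt0n.
move: A0; set A := r ^+ N / _ => A0; set W := erlangBinv _ _.
have -> : (1 - r / N%:R) * (A * (W - 1)) + A =
  A * (1 - (r - N%:R) / N%:R * (W - 1)) by field.
by rewrite invfM mulrA divff // mul1r.
Qed.

Lemma erlangBinv_ge1 (R : realType) (N : nat) (r : R) : 0 < r -> 1 <= erlangBinv N r.
Proof.
move=> r0; elim: N => [|N IH]; first by rewrite erlangBinv0.
by rewrite erlangBinvS // lerDl mulr_ge0 ?divr_ge0 ?(ltW r0) // (le_trans _ IH).
Qed.

(** As long as [N + 1 <= r] the left side is nonpositive. Beyond that the factor [(N + 1) / r] of
    the recursion exceeds 1, so each step adds at least 1 to the bound. *)
Lemma erlangBinv_ge_slack (R : realType) (N : nat) (r : R) : 0 < r ->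
  N%:R - r <= erlangBinv N r - 1.
Proof.
move=> r0; elim: N => [|N IH]; first by rewrite erlangBinv0; lra.
have W1 := erlangBinv_ge1 N r0.
have [Nr|Nr] := leP N.+1%:R r.
  by have := erlangBinv_ge1 N.+1 r0; lra.
rewrite erlangBinvS // (addrAC 1) subrr add0r (@le_trans _ _ (erlangBinv N r)) //.
  by rewrite -natr1; lra.
by rewrite ler_peMl ?(le_trans _ W1)// ler_pdivlMr ?mul1r ?ltW.
Qed.

Lemma erlangBinv_ge (R : realType) (N : nat) (r : R) : 0 < r -> N%:R <= r ->
  N%:R * (r - N%:R) / ((r - N%:R) ^+ 2 + r) <= erlangBinv N r - 1.
Proof.
move=> r0; elim: N => [|N IH] Nr; first by rewrite erlangBinv0 subrr !mul0r.
move: Nr; rewrite -natr1 => Nr.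
have {}IH := IH ltac:(lra).
rewrite erlangBinvS // (addrAC 1) subrr add0r.
have W' : 1 + N%:R * (r - N%:R) / ((r - N%:R) ^+ 2 + r) <= erlangBinv N r by lra.
rewrite -natr1 (@le_trans _ _ ((N%:R + 1) / r *
  (1 + N%:R * (r - N%:R) / ((r - N%:R) ^+ 2 + r)))) //; last first.
  by rewrite ler_wpM2l // divr_ge0 ?ltW //; have := ler0n R N; lra.
have := ler0n R N; move: (N%:R : R) Nr => n nr n0.
rewrite -mulrA -[X in _ <= X]mulrA; apply: ler_wpM2l; first lra.
have p1 : 0 < (r - n) ^+ 2 + r by have := sqr_ge0 (r - n); lra.
have p2 : 0 < (r - (n + 1)) ^+ 2 + r by have := sqr_ge0 (r - (n + 1)); lra.
(* The common factor [n + 1] is gone; the gap that the induction step leaves is an explicit positive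
   fraction. *)
rewrite -subr_ge0.
suff -> : r^-1 * (1 + n * (r - n) / ((r - n) ^+ 2 + r)) -
  (r - (n + 1)) / ((r - (n + 1)) ^+ 2 + r) =
  (1 + r + n) / (((r - n) ^+ 2 + r) * ((r - (n + 1)) ^+ 2 + r)).
  by rewrite divr_ge0 ?mulr_ge0 ?ltW //; lra.
by field; rewrite !gt_eqF.
Qed.

(** This keeps [1 / C] away from 0 in overload. The factor [r - N] stays on the left, so that
    dividing by [N] yields the lower bound on [1 / C] directly. *)
Lemma erlangBinv_le (R : realType) (N : nat) (r : R) : 0 < r -> N%:R < r ->
  (r - N%:R) * (erlangBinv N r - 1) <=
    N%:R * (1 - r / (4 * ((r - N%:R) ^+ 2 + r))).
Proof.
move=> r0; elim: N => [|N IH] Nr; first by rewrite erlangBinv0 subrr mulr0 mul0r.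
move: Nr; rewrite -natr1 => Nr.
have {}IH := IH ltac:(lra).
rewrite erlangBinvS // (addrAC 1) subrr add0r -natr1.
have := ler0n R N; move: (N%:R : R) (erlangBinv N r) Nr IH => n W nr IH n0.
have p1 : 0 < (r - n) ^+ 2 + r by have := sqr_ge0 (r - n); lra.
have p2 : 0 < (r - (n + 1)) ^+ 2 + r by have := sqr_ge0 (r - (n + 1)); lra.
have W' : W <= 1 + n * (1 - r / (4 * ((r - n) ^+ 2 + r))) / (r - n).
  rewrite -lerBlDl ler_pdivlMr; [by rewrite mulrC|lra].
rewrite (@le_trans _ _ ((r - (n + 1)) * ((n + 1) / r *
  (1 + n * (1 - r / (4 * ((r - n) ^+ 2 + r))) / (r - n))))) //.
  do 2 (apply: ler_wpM2l; first by rewrite ?divr_ge0; lra).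
  exact: W'.
rewrite -subr_ge0.
(* The new excess [y] replaces [n], so that the difference becomes a rational function of [r] and
   [y] on [0 < y <= r - 1]. *)
move y_def : (r - (n + 1)) => y.
have y0 : 0 < y by lra.
have -> : r - n = y + 1 by lra.
have -> : n = r - y - 1 by lra.
have ry : y + 1 <= r by lra.
move: p1 p2; rewrite y_def (_ : r - n = y + 1); last by lra.
move=> {W' IH W nr n0 y_def} p1 p2.
set P := (y + 1) ^+ 2 + r; set Q := y ^+ 2 + r.
suff -> : (r - y - 1 + 1) * (1 - r / (4 * Q)) - y *
  ((r - y - 1 + 1) / r * (1 + (r - y - 1) * (1 - r / (4 * P)) / (y + 1))) =
  (r - y) * (4 * P * Q - r * (y + 1) * P + y * (r - y - 1) * Q) / (4 * (y + 1) * P * Q).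
  rewrite divr_ge0 //; last by rewrite !mulr_ge0 ?ltW //; lra.
  rewrite mulr_ge0 //; [lra|].
  (* Since [P - Q = 2 y + 1], the second factor is [4 P Q - r P - r y (2 y + 1) - y (y + 1) Q]. The
     constant 4 suffices because [P Q] dominates [r P], [P Q] dominates [y (y + 1) Q], and [2 P Q]
     dominates [r y (2 y + 1)]. *)
  rewrite /P /Q; nra.
by rewrite /P /Q; field; rewrite !gt_eqF //; lra.
Qed.

(** * Exponential bounds on the terms of the inverse Erlang-B sum *)

Lemma ffact_expr_le (R : realType) (N k : nat) (r : R) : 0 < r -> (0 < N)%N ->
  (N ^_ k)%:R / r ^+ k <=
  expR (k%:R * ((N%:R - r) / r) - k%:R * (k%:R - 1) / 2 / N%:R).
Proof.
move=> r0 N0; have N1 : 0 < N%:R :> R by rewrite ltr0n.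
have r_ge0 := ltW r0.
elim: k => [|k IH]; first by rewrite ffactn0 expr0 !mul0r subrr expR0 divr1.
rewrite ffactnSr natrM exprSr invfM mulrACA.
have -> : k.+1%:R * ((N%:R - r) / r) - k.+1%:R * (k.+1%:R - 1) / 2 / N%:R =
  (k%:R * ((N%:R - r) / r) - k%:R * (k%:R - 1) / 2 / N%:R) +
  ((N%:R - r) / r - k%:R / N%:R) :> R.
  by rewrite -natr1; field; rewrite !gt_eqF.
rewrite expRD ler_pM ?divr_ge0 ?exprn_ge0 //.
have [kN|Nk] := leqP k N; last first.
  by rewrite (eqP (ltnW Nk)) mul0r expR_ge0.
(* Each factor is bounded by [1 + x <= expR x]; over the product, the exponents [- j / N] with
   [j < k] add up to [- k (k - 1) / 2 / N]. *)
have -> : (N - k)%:R / r = (1 + (N%:R - r) / r) * (1 + - (k%:R / N%:R)) :> R.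
  by rewrite natrB //; field; rewrite !gt_eqF.
rewrite expRD ler_pM ?expR_ge1Dx //.
  by rewrite mulrBl divff ?gt_eqF // addrC subrK divr_ge0.
by rewrite subr_ge0 ler_pdivrMr // mul1r ler_nat.
Qed.

(** A lower bound comes from applying [1 + x <= expR x] to the inverse factors [r / (N - j) = (1 +
    (r - N) / N) (1 + j / (N - j))]. Replacing [N - j] by the fixed [N - m] lets the exponents sum
    in closed form. *)
Lemma ffact_expr_ge (R : realType) (N m k : nat) (r : R) : 0 < r ->
  (m < N)%N -> (k <= m)%N ->
  expR (- (k%:R * ((r - N%:R) / N%:R)) - k%:R * (k%:R - 1) / 2 / (N%:R - m%:R)) <=
  (N ^_ k)%:R / r ^+ k.
Proof.
move=> r0 mN; have N1 : 0 < N%:R :> R by rewrite ltr0n (leq_ltn_trans _ mN).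
have mN' : 0 < N%:R - m%:R :> R by rewrite subr_gt0 ltr_nat.
elim: k => [|k IH] km.
  by rewrite ffactn0 expr0 !mul0r !oppr0 addr0 expR0 divr1.
have {}IH := IH (ltnW km).
have kN : (k < N)%N := leq_trans km (ltnW mN).
rewrite ffactnSr natrM exprSr invfM mulrACA.
have -> : - (k.+1%:R * ((r - N%:R) / N%:R)) - k.+1%:R * (k.+1%:R - 1) / 2 / (N%:R - m%:R) =
  (- (k%:R * ((r - N%:R) / N%:R)) - k%:R * (k%:R - 1) / 2 / (N%:R - m%:R)) +
  - ((r - N%:R) / N%:R + k%:R / (N%:R - m%:R)) :> R.
  by rewrite -natr1; field; rewrite !gt_eqF.
rewrite expRD ler_pM ?expR_ge0 //.
have Nk : 0 < (N - k)%:R :> R by rewrite ltr0n subn_gt0.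
rewrite expRN -[X in _ <= X]invrK lef_pV2 ?posrE ?expR_gt0 ?invr_gt0 ?divr_gt0 //.
have -> : ((N - k)%:R / r)^-1 = (1 + (r - N%:R) / N%:R) * (1 + k%:R / (N%:R - k%:R)) :> R.
  by rewrite natrB ?(ltnW kN) //; field; rewrite subr_eq0 !gt_eqF // ltr_nat.
rewrite expRD ler_pM ?expR_ge1Dx //.
- by rewrite mulrDl mulNr divff ?gt_eqF // addrC subrK divr_ge0 ?ltW.
- by rewrite addr_ge0 ?divr_ge0 // subr_ge0 ler_nat ltnW.
- apply: (le_trans (expR_ge1Dx _)); rewrite ler_expR ler_wpM2l //.
  by rewrite lef_pV2 ?posrE // ?subr_gt0 ?ltr_nat // lerB // ler_nat ltnW.
Qed.

(** * Sums as integrals of step functions *)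

Definition step_fun (R : realType) (b : nat -> R) (n : nat) (z s t : R) : R :=
  \sum_(k < n) b k * \1_(`[z + k%:R / s, z + k.+1%:R / s[) t.

Lemma measurable_step_fun (R : realType) (b : nat -> R) (n : nat) (z s : R) (D : set R) :
  measurable_fun D (step_fun b n z s).
Proof.
by apply: measurable_sum => k; apply: measurable_funM.
Qed.

(** The half-open steps are disjoint, and [t] lies in the one indexed by the integer part of
    [(t - z) * s]. Past the last step both sides vanish, by the assumption on [b]. *)
Lemma step_funE (R : realType) (b : nat -> R) (n : nat) (z s t : R) :
  0 < s -> z <= t -> (forall k, (n <= k)%N -> b k = 0) ->
  step_fun b n z s t = b (Num.trunc ((t - z) * s)).
Proof.
move=> s0 zt bn; set K := Num.trunc _.
have zts : 0 <= (t - z) * s by rewrite mulr_ge0 ?subr_ge0 // ltW.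
have indE k : (t \in `[z + k%:R / s, z + k.+1%:R / s[%classic) = (K == k).
  rewrite mem_setE in_itv /= truncn_eq // -lerBrDl -ltrBlDl.
  by rewrite ler_pdivrMr // ltr_pdivlMr.
rewrite /step_fun; have [Kn|nK] := ltnP K n; last first.
  rewrite bn // big1 // => k _; rewrite indicE indE.
  by rewrite gtn_eqF ?mulr0 // (leq_trans (ltn_ord k)).
rewrite (bigD1 (Ordinal Kn)) //= indicE indE eqxx mulr1 big1 ?addr0 // => k kK.
by rewrite indicE indE eq_sym -(inj_eq val_inj) /= in kK * ; rewrite (negbTE kK) mulr0.
Qed.

Lemma integral_step_fun (R : realType) (b : nat -> R) (n : nat) (z s : R) :
  0 < s -> (forall k, 0 <= b k) ->
  (\int[lebesgue_measure]_(t in `[z, +oo[) (step_fun b n z s t)%:E)%E =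
  ((\sum_(k < n) b k) / s)%:E.
Proof.
move=> s0 b0.
under eq_integral do rewrite -sumEFin.
rewrite ge0_integral_sum //; last 2 first.
- move=> k; by apply/measurable_EFinP; apply: measurable_funM.
- by move=> k t _; rewrite lee_fin mulr_ge0.
rewrite mulr_suml -sumEFin; apply: eq_bigr => k _.
under eq_integral do rewrite EFinM.
rewrite ge0_integralZl_EFin //; last by apply/measurable_EFinP.
rewrite integral_indic //= (_ : _ `&` _ = `[z + k%:R / s, z + k.+1%:R / s[%classic).
  rewrite lebesgue_measure_itv /= lte_fin ltrD2l ltr_pM2r ?invr_gt0 // ltr_nat ltnSn.
  rewrite -EFinD -EFinM; congr (_ * _)%:E.
  by rewrite opprD addrACA subrr add0r -mulrBl -natr1 addrAC subrr add0r mul1r.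
apply/setIidl => t /=; rewrite !in_itv /= andbT => /andP[+ _].
by apply: le_trans; rewrite lerDl divr_ge0 // ltW.
Qed.

(** * Pointwise limit of the terms and their Gaussian bound *)

Lemma cvg_ffact_expr (R : realType) (n k : nat -> nat) (r : nat -> R) (z u : R) :
  (forall i, (0 < n i)%N) -> (forall i, 0 < r i) ->
  Num.sqrt (n i)%:R @[i --> \oo] --> (+oo : set_system R) ->
  (r i - (n i)%:R) / Num.sqrt (n i)%:R @[i --> \oo] --> z ->
  (k i)%:R / Num.sqrt (n i)%:R @[i --> \oo] --> u ->
  ((n i) ^_ (k i))%:R / r i ^+ k i @[i --> \oo] --> expR (- (z * u) - u ^+ 2 / 2).
Proof.
move=> n0 r0 noo; pose s i : R := Num.sqrt (n i)%:R.
change (s i @[i --> \oo] --> (+oo : set_system R)) in noo.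
have s0 i : 0 < s i by rewrite sqrtr_gt0 ltr0n.
have sq i : (n i)%:R = s i ^+ 2 by rewrite sqr_sqrtr.
pose zeta i := (r i - (n i)%:R) / s i; pose kap i := (k i)%:R / s i.
rewrite -[X in X -> _]/(zeta i @[i --> \oo] --> z)
  -[X in _ -> X -> _]/(kap i @[i --> \oo] --> u).
move=> zetaz kapu.
have sV : (s i)^-1 @[i --> \oo] --> 0 by apply/gtr0_cvgV0 => //; exact: nearW.
(* The exponents of the two bounds are rewritten in [zeta], [kap] and [1 / s]. The limit is put in
   the shape of the upper one, with 0 standing for the limit of [1 / s]. *)
have -> : expR (- (z * u) - u ^+ 2 / 2) =
  expR (- (z * u / (1 + z * 0)) - u * (u - 0) / 2).
  by rewrite mulr0 addr0 divr1 subr0 expr2.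
have c1 : - (zeta i * kap i / (1 + zeta i * (s i)^-1))
  - kap i * (kap i - (s i)^-1) / 2 @[i --> \oo] -->
   - (z * u / (1 + z * 0)) - u * (u - 0) / 2.
  apply: cvgB; [apply: cvgN; apply: cvgM;
    [exact: cvgM|apply: cvgV; [by rewrite mulr0 ?addr0 ?subr0 oner_neq0|]]|].
    by apply: cvgD; [exact: cvg_cst|exact: cvgM].
  by apply: cvgMl; apply: cvgM => //; exact: cvgB.
have c2 : - (zeta i * kap i)
  - kap i * (kap i - (s i)^-1) / 2 / (1 - kap i * (s i)^-1) @[i --> \oo] -->
   - (z * u / (1 + z * 0)) - u * (u - 0) / 2.
  have -> : - (z * u / (1 + z * 0)) - u * (u - 0) / 2 =
    - (z * u) - u * (u - 0) / 2 / (1 - u * 0).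
    by rewrite !mulr0 addr0 !subr0 !divr1.
  apply: cvgB; [apply: cvgN; exact: cvgM|].
  apply: cvgM; [by apply: cvgMl; apply: cvgM => //; exact: cvgB|].
  apply: cvgV; first by rewrite mulr0 subr0 oner_neq0.
  by apply: cvgB; [exact: cvg_cst|exact: cvgM].
apply: (@squeeze_cvgr _ _ _ _ (expR \o _) (expR \o _) _ _ _
  (continuous_cvg _ (@continuous_expR _ _) c2) (continuous_cvg _ (@continuous_expR _ _) c1)).
near=> i.
(* As [kap] stays bounded while [s] diverges, eventually [k < n], and the lower bound applies with
   [m = k]. *)
have kaps : kap i < s i.
  rewrite (@lt_trans _ _ (u + 1)) //.
    by near: i; apply: (cvgr_lt u) => //; lra.
  by near: i; move/cvgryPgt : noo; exact.
have ki : (k i < n i)%N.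
  by rewrite -(ltr_nat R) sq expr2 -ltr_pdivrMr.
have ri : r i = s i ^+ 2 * (1 + zeta i * (s i)^-1).
  by rewrite /zeta -/(s i) sq; field; rewrite gt_eqF.
have zs : 0 < 1 + zeta i * (s i)^-1.
  by have := r0 i; rewrite ri pmulr_rgt0 ?exprn_gt0.
have kapE : (k i)%:R = kap i * s i by rewrite /kap divfK ?gt_eqF.
apply/andP; split.
- apply: (le_trans _ (ffact_expr_ge (r0 i) ki (leqnn _))).
  rewrite ler_expR le_eqVlt; apply/orP; left; apply/eqP.
  rewrite ri sq kapE; field.
  have -> : s i ^+ 2 - kap i * s i = s i * (s i - kap i) by ring.
  have sk : s i - kap i != 0 by rewrite gt_eqF // subr_gt0.
  have sn : s i != 0 by rewrite gt_eqF.
  by rewrite mulf_neq0 //= sn.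
- apply: (le_trans (ffact_expr_le (k i) (r0 i) (n0 i))).
  rewrite ler_expR le_eqVlt; apply/orP; left; apply/eqP.
  rewrite ri sq kapE; field.
  have sn : s i != 0 by rewrite gt_eqF.
  have -> : s i + zeta i = s i * (1 + zeta i * (s i)^-1) by field.
  by rewrite mulf_neq0 ?sn //= gt_eqF.
Unshelve. all: by end_near. Qed.

Lemma ffact_expr_gauss_le (R : realType) (n k : nat) (r M u : R) :
  (0 < n)%N -> 0 < r -> 0 <= M -> (n%:R - r) / r <= M / Num.sqrt n%:R ->
  k%:R <= u * Num.sqrt n%:R < k.+1%:R ->
  (n ^_ k)%:R / r ^+ k <= expR ((M + 2) ^+ 2 / 2) * expR (- (u - (M + 2)) ^+ 2 / 2).
Proof.
move=> n0 r0 M0 nr /andP[ku uk].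
apply: (le_trans (ffact_expr_le k r0 n0)).
rewrite -expRD ler_expR.
have s1 : 1 <= Num.sqrt n%:R :> R by rewrite -{1}sqrtr1 ler_wsqrtr // ler1n.
have sq : n%:R = (Num.sqrt n%:R) ^+ 2 :> R by rewrite sqr_sqrtr.
set s := Num.sqrt n%:R in nr ku uk s1 sq *.
have s0 : 0 < s by lra.
have h1 : k%:R * ((n%:R - r) / r) <= u * M.
  apply: (@le_trans _ _ (k%:R * (M / s))); first by rewrite ler_wpM2l.
  by rewrite mulrA ler_pdivrMr // mulrAC ler_wpM2r.
have u0 : 0 <= u by have := ler0n R k; nra.
(* Rounding [u s] down to [k] costs at most [3 u s] in [k (k - 1)], and [s >= 1] makes this at most
   [3 u s ^+ 2]. With [u >= 0], [3 / 2] is then rounded up to the 2 in [M + 2], and completing the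
   square gives the Gaussian. *)
have h2 : u ^+ 2 / 2 - 3 / 2 * u <= k%:R * (k%:R - 1) / 2 / n%:R.
  rewrite sq ler_pdivlMr ?exprn_gt0 //.
  rewrite -natr1 in uk; have := ler0n R k.
  move: (k%:R : R) ku uk => x ku uk x0.
  have h3 : (u * s) ^+ 2 - 3 * (u * s) <= x * (x - 1) by nra.
  have h4 : u * s <= u * s ^+ 2 by rewrite expr2 mulrA ler_peMr // mulr_ge0 // ltW.
  move: h3; rewrite exprMn; lra.
nra.
Qed.

Lemma cvg_truncn_div (R : realType) (s : nat -> R) (u : R) : 0 <= u ->
  (forall i, 0 < s i) -> s i @[i --> \oo] --> (+oo : set_system R) ->
  (Num.trunc (u * s i))%:R / s i @[i --> \oo] --> u.
Proof.
move=> u0 s0 soo.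
have sV : (s i)^-1 @[i --> \oo] --> 0 by apply/gtr0_cvgV0 => //; exact: nearW.
have c1 : u - (s i)^-1 @[i --> \oo] --> u.
  by rewrite -[X in _ --> X]subr0; apply: cvgB => //; exact: cvg_cst.
apply: (squeeze_cvgr _ c1 (@cvg_cst _ _ _ _ _)).
apply: nearW => i; have /truncn_itv/andP[h1 h2] : 0 <= u * s i by rewrite mulr_ge0 // ltW.
rewrite ler_pdivrMr // h1 andbT ler_pdivlMr // mulrBl mulVf ?gt_eqF //.
by move: h2; rewrite -natr1; lra.
Qed.

(** * Dominated convergence for the inverse Erlang-B formula *)

Lemma cvg_erlangBinv_bounded (R : realType) (n : nat -> nat) (r : nat -> R) (z M : R) :
  (forall i, (0 < n i)%N) -> (forall i, 0 < r i) -> 0 <= M ->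
  (forall i, ((n i)%:R - r i) / r i <= M / Num.sqrt (n i)%:R) ->
  Num.sqrt (n i)%:R @[i --> \oo] --> (+oo : set_system R) ->
  (r i - (n i)%:R) / Num.sqrt (n i)%:R @[i --> \oo] --> z ->
  erlangBinv (n i) (r i) / Num.sqrt (n i)%:R @[i --> \oo] --> Phic z / phi z.
Proof.
move=> n0 r0 M0 nrM noo zetaz.
have s0 i : 0 < Num.sqrt (n i)%:R :> R by rewrite sqrtr_gt0 ltr0n.
pose b i k := ((n i) ^_ k)%:R / r i ^+ k.
have b0 i k : 0 <= b i k by rewrite divr_ge0 // exprn_ge0 // ltW.
have bn i k : ((n i).+1 <= k)%N -> b i k = 0.
  by move=> nk; rewrite /b ffact_small // mul0r.
(* The limit [f t] is [phi t / phi z]. In the dominating [g], the constant [K] cancels the peak of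
   the normal density, leaving exactly the bound of [ffact_expr_gauss_le] at [u = t - z]. *)
pose f t := expR (z ^+ 2 / 2 - t ^+ 2 / 2).
pose K := expR ((M + 2) ^+ 2 / 2) / normal_peak 1.
pose g t := K * normal_pdf (z + (M + 2)) 1 t.
have mD : measurable (`[z, +oo[%classic : set (measurableTypeR R)) by [].
have mf : measurable_fun `[z, +oo[ f.
  apply: measurableT_comp => //; apply: measurable_funB => //.
  by apply: measurable_funM => //; exact: measurable_funX.
have [intf _] : [/\ lebesgue_measure.-integrable `[z, +oo[ (EFin \o f),
    [sequence \int[lebesgue_measure]_(t in `[z, +oo[)
      `|(step_fun (b i) (n i).+1 z (Num.sqrt (n i)%:R) t)%:E - (f t)%:E|]_i @ \oo --> 0 &
    [sequence \int[lebesgue_measure]_(t in `[z, +oo[)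
      (step_fun (b i) (n i).+1 z (Num.sqrt (n i)%:R) t)%:E]_i @ \oo -->
    \int[lebesgue_measure]_(t in `[z, +oo[) (f t)%:E]%E.
  apply: (@dominated_convergence _ (measurableTypeR R) R lebesgue_measure _ mD (fun i t =>
    (step_fun (b i) (n i).+1 z (Num.sqrt (n i)%:R) t)%:E)
    (EFin \o f) (EFin \o g)) => //.
  - by move=> i; apply/measurable_EFinP; exact: measurable_step_fun.
  - exact/measurable_EFinP.
  - apply: aeW => t /=; rewrite in_itv /= andbT => zt.
    apply: cvg_EFin; first exact: nearW.
    rewrite (_ : fine \o _ = fun i =>
      b i (Num.trunc ((t - z) * Num.sqrt (n i)%:R))); last first.
      by apply/funext => i; rewrite /= (step_funE (s0 i) zt (bn i)).
    have -> : f t = expR (- (z * (t - z)) - (t - z) ^+ 2 / 2).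
      by rewrite /f; congr expR; field.
    apply: cvg_ffact_expr => //.
    by apply: cvg_truncn_div => //; rewrite subr_ge0.
  - rewrite (_ : EFin \o g = fun t => (K%:E * (normal_pdf (z + (M + 2)) 1 t)%:E)%E) //.
    apply: integrableZl => //.
    exact: (integrableS measurableT _ _ (integrable_normal_pdf _ _)).
  - apply: aeW => t i /=; rewrite in_itv /= andbT => zt.
    rewrite lee_fin (step_funE (s0 i) zt (bn i)) ger0_norm // /g /K normal_pdfE ?oner_neq0 //.
    rewrite mulrA divfK ?gt_eqF ?normal_peak_gt0 ?oner_neq0 //.
    rewrite /normal_fun expr1n (_ : t - (z + (M + 2)) = (t - z) - (M + 2)); last by ring.
    apply: (ffact_expr_gauss_le (n0 i) (r0 i) M0 (nrM i)); apply: truncn_itv.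
    by rewrite mulr_ge0 ?subr_ge0 // ltW.
have -> : Phic z / phi z = \int[lebesgue_measure]_(t in `[z, +oo[) f t.
  rewrite -[RHS](mulKf (_ : phi z != 0)); last first.
    by rewrite /phi mulf_neq0 ?gt_eqF ?expR_gt0 // invr_gt0 sqrtr_gt0 mulr_gt0 ?pi_gt0.
  rewrite [LHS]mulrC; congr *%R; rewrite -RintegralZl //; apply: eq_Rintegral => t _.
  by rewrite /phi /f -mulrA -expRD; congr (_ * expR _); field.
have fin : (\int[lebesgue_measure]_(t in `[z, +oo[) (f t)%:E)%E \is a fin_num.
  exact: integrable_fin_num.
rewrite -(fineK fin) => /fine_cvgP[_].
apply: cvg_trans; apply: near_eq_cvg; apply: nearW => i /=.
by rewrite integral_step_fun.
Qed.

(** Domination asks for one [M] valid along the whole sequence. The convergence to [z] provides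
    [M = |z| + 1] from some index [i0] on, and shifting the sequences by [i0] does not change the
    limit. *)
Lemma cvg_erlangBinv (R : realType) (n : nat -> nat) (r : nat -> R) (z : R) :
  (\forall i \near \oo, (0 < n i)%N) -> (\forall i \near \oo, 0 < r i) ->
  Num.sqrt (n i)%:R @[i --> \oo] --> (+oo : set_system R) ->
  (r i - (n i)%:R) / Num.sqrt (n i)%:R @[i --> \oo] --> z ->
  erlangBinv (n i) (r i) / Num.sqrt (n i)%:R @[i --> \oo] --> Phic z / phi z.
Proof.
move=> n0 r0 noo zetaz.
have sV : (Num.sqrt (n i)%:R)^-1 @[i --> \oo] --> (0 : R).
  by apply/gtr0_cvgV0 => //; near do rewrite sqrtr_gt0 ltr0n.
(* This expression is [(n - r) / r] multiplied by [sqrt n]; its limit [- z] is strictly below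
   [|z| + 1]. *)
have c : - ((r i - (n i)%:R) / Num.sqrt (n i)%:R) /
  (1 + (r i - (n i)%:R) / Num.sqrt (n i)%:R / Num.sqrt (n i)%:R) @[i --> \oo] -->
  - z / (1 + z * 0).
  apply: cvgM; first exact: cvgN.
  apply: cvgV; first by rewrite mulr0 addr0 oner_neq0.
  by apply: cvgD; [exact: cvg_cst|exact: cvgM].
have [i0 _ Hi0] : \forall i \near \oo, [/\ (0 < n i)%N, 0 < r i &
  ((n i)%:R - r i) / r i <= (`|z| + 1) / Num.sqrt (n i)%:R].
  near=> i.
  have n0i : (0 < n i)%N by near: i.
  have r0i : 0 < r i by near: i.
  split => //.
  have s0 : 0 < Num.sqrt (n i)%:R :> R by rewrite sqrtr_gt0 ltr0n.
  have -> : ((n i)%:R - r i) / r i = - ((r i - (n i)%:R) / Num.sqrt (n i)%:R) /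
    (1 + (r i - (n i)%:R) / Num.sqrt (n i)%:R / Num.sqrt (n i)%:R) / Num.sqrt (n i)%:R.
    have alg (s x : R) : s != 0 -> x != 0 -> (s ^+ 2 - x) / x =
        - ((x - s ^+ 2) / s) / (1 + (x - s ^+ 2) / s / s) / s.
      move=> ? ?; field; apply/andP; split => //.
      by rewrite (_ : _ + _ = x) //; ring.
    by have := alg (Num.sqrt (n i)%:R) (r i); rewrite sqr_sqrtr // => ->; rewrite ?gt_eqF.
  rewrite ler_pM2r ?invr_gt0 //; near: i; apply: (cvgr_le _ c).
  by rewrite mulr0 addr0 divr1 (le_lt_trans (ler_norm _)) // normrN ltrDl.
rewrite -(cvg_shiftn i0) /=.
apply: (@cvg_erlangBinv_bounded _ (fun i => n (i + i0)%N) (fun i => r (i + i0)%N)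
  z (`|z| + 1)).
- by move=> i; have [] := Hi0 (i + i0)%N (leq_addl _ _).
- by move=> i; have [] := Hi0 (i + i0)%N (leq_addl _ _).
- by rewrite addr_ge0.
- by move=> i; have [] := Hi0 (i + i0)%N (leq_addl _ _).
- by rewrite (cvg_shiftn i0 (fun i => Num.sqrt (n i)%:R : R)).
- by rewrite (cvg_shiftn i0 (fun i => (r i - (n i)%:R) / Num.sqrt (n i)%:R : R)).
Unshelve. all: by end_near. Qed.

(** * Limits when the excess is at most of order [sqrt lambda] *)

Lemma sqrtr_cvgy (R : realType) : Num.sqrt x @[x --> +oo] --> (+oo : set_system R).
Proof.
apply/cvgryPge => A; near=> x.
by rewrite (le_trans (ler_norm _)) // -sqrtr_sqr ler_wsqrtr.
Unshelve. all: by end_near. Qed.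

Lemma near_nat_gt0 (R : realType) (N : R -> nat) :
  (forall x : R, 0 < x -> (1 <= N x)%N) -> \forall x \near +oo, (0 < N x)%N.
Proof. by move=> N1; near=> x; apply: N1. Unshelve. all: by end_near. Qed.

(** The sign of [c] is free, so this serves the three middle regimes at once. The assumption forces
    [N / x] to tend to [1 / mu], which converts the scale [sqrt x] into [sqrt N] at the cost of the
    factor [sqrt mu]. *)
Lemma erlang_moderate_cvg (R : realType) (mu c : R) (N : R -> nat) : 0 < mu ->
  (forall x, 0 < x -> (1 <= N x)%N) ->
  (x / mu - (N x)%:R) / Num.sqrt x @[x --> +oo] --> c ->
  (x / mu - (N x)%:R) / Num.sqrt (N x)%:R @[x --> +oo] --> c * Num.sqrt mu /\
  1 - (x / mu - (N x)%:R) / (N x)%:R * (erlangBinv (N x) (x / mu) - 1)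
    @[x --> +oo] --> 1 - xi (c * Num.sqrt mu).
Proof.
move=> mu0 N1 ec.
have N0 := near_nat_gt0 N1.
have sV : (Num.sqrt x)^-1 @[x --> +oo] --> (0 : R).
  apply/gtr0_cvgV0; last exact: sqrtr_cvgy.
  by near=> x; rewrite sqrtr_gt0.
have smu : 0 < Num.sqrt mu^-1 by rewrite sqrtr_gt0 invr_gt0.
have NxE : \forall x \near +oo,
    mu^-1 - (x / mu - (N x)%:R) / Num.sqrt x / Num.sqrt x = (N x)%:R / x.
  near=> x.
  have x0 : 0 < x by near: x; exact: nbhs_pinfty_gt.
  rewrite -mulrA -invfM -expr2 sqr_sqrtr ?(ltW x0) //.
  by field; rewrite !gt_eqF.
have Nx : (N x)%:R / x @[x --> +oo] --> mu^-1.
  rewrite -[X in _ --> X]subr0 -[X in _ - X](mulr0 c).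
  apply: (cvg_trans (near_eq_cvg NxE)).
  by apply: cvgB; [exact: cvg_cst|exact: cvgM].
have sNx : Num.sqrt ((N x)%:R / x) @[x --> +oo] --> Num.sqrt mu^-1.
  exact: (continuous_cvg _ (@sqrt_continuous R _) Nx).
have sNE x : 0 < x -> Num.sqrt (N x)%:R = Num.sqrt ((N x)%:R / x) * Num.sqrt x.
  by move=> x0; rewrite -sqrtrM ?divfK ?gt_eqF // divr_ge0 // ltW.
have sNV : (Num.sqrt (N x)%:R)^-1 @[x --> +oo] --> (0 : R).
  have E : \forall x \near +oo,
    (Num.sqrt ((N x)%:R / x))^-1 * (Num.sqrt x)^-1 = (Num.sqrt (N x)%:R)^-1.
    near=> x; rewrite [in RHS]sNE ?invfM //; near: x; exact: nbhs_pinfty_gt.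
  rewrite -[X in _ --> X](mulr0 (Num.sqrt mu^-1)^-1).
  apply: (cvg_trans (near_eq_cvg E)).
  by apply: cvgM => //; apply: cvgV; rewrite ?gt_eqF.
have sNy : Num.sqrt (N x)%:R @[x --> +oo] --> (+oo : set_system R).
  by apply/gtr0_cvgV0 => //; near=> x; rewrite sqrtr_gt0 ltr0n; near: x.
have scz : (x / mu - (N x)%:R) / Num.sqrt (N x)%:R @[x --> +oo] --> c * Num.sqrt mu.
  have E : \forall x \near +oo, (x / mu - (N x)%:R) / Num.sqrt x / Num.sqrt ((N x)%:R / x) =
     (x / mu - (N x)%:R) / Num.sqrt (N x)%:R.
    by near=> x; rewrite [in RHS]sNE // invfM mulrA mulrAC.
  apply: (cvg_trans (near_eq_cvg E)).
  have -> : Num.sqrt mu = (Num.sqrt mu^-1)^-1 by rewrite sqrtrV ?invrK // ltW.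
  by apply: cvgM => //; apply: cvgV; rewrite ?gt_eqF.
split=> //.
have Wz : erlangBinv (N x) (x / mu) / Num.sqrt (N x)%:R @[x --> +oo] -->
    Phic (c * Num.sqrt mu) / phi (c * Num.sqrt mu).
  (* Dominated convergence is about sequences, so the limit in [x] is tested along every sequence
     [u] tending to infinity. *)
  apply/(cvg_pinftyP (fun x => erlangBinv (N x) (x / mu) / Num.sqrt (N x)%:R)) => u uoo.
  apply: (@cvg_erlangBinv _ (fun i => N (u i)) (fun i => u i / mu)).
  - exact: (uoo _ N0).
  - apply: (uoo [set x | 0 < x / mu]); near=> x.
    by rewrite /= divr_gt0.
  - by move=> B sB; exact: (uoo _ (sNy _ sB)).
  - by move=> B sB; exact: (uoo _ (scz _ sB)).
have E : \forall x \near +oo, 1 - (x / mu - (N x)%:R) / Num.sqrt (N x)%:R *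
   (erlangBinv (N x) (x / mu) / Num.sqrt (N x)%:R - (Num.sqrt (N x)%:R)^-1) =
   1 - (x / mu - (N x)%:R) / (N x)%:R * (erlangBinv (N x) (x / mu) - 1).
  near=> x.
  have s0 : 0 < Num.sqrt (N x)%:R :> R by rewrite sqrtr_gt0 ltr0n; near: x.
  have sq : (Num.sqrt (N x)%:R) ^+ 2 = (N x)%:R :> R by rewrite sqr_sqrtr.
  have alg (e s W : R) : s != 0 -> 1 - e / s * (W / s - s^-1) = 1 - e / s ^+ 2 * (W - 1).
    by move=> ?; field.
  by rewrite alg ?sq // gt_eqF.
apply: (cvg_trans (near_eq_cvg E)).
apply: cvgB; first exact: cvg_cst.
rewrite /xi; apply: cvgM => //.
by rewrite -[X in _ --> X]subr0; apply: cvgB.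
Unshelve. all: by end_near. Qed.

Lemma erlangCE_near (R : realType) (mu : R) (N : R -> nat) : 0 < mu ->
  (forall x, 0 < x -> (1 <= N x)%N) ->
  \forall x \near +oo,
  (1 - (x / mu - (N x)%:R) / (N x)%:R * (erlangBinv (N x) (x / mu) - 1))^-1 =
  erlangC (N x) (x / mu).
Proof.
move=> mu0 N1; near=> x.
have x0 : 0 < x by near: x; exact: nbhs_pinfty_gt.
by rewrite erlangCE ?divr_gt0 ?N1.
Unshelve. all: by end_near. Qed.

Lemma erlangC_moderate_cvg (R : realType) (mu c : R) (N : R -> nat) : 0 < mu ->
  (forall x, 0 < x -> (1 <= N x)%N) ->
  (x / mu - (N x)%:R) / Num.sqrt x @[x --> +oo] --> c ->
  1 - xi (c * Num.sqrt mu) != 0 ->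
  erlangC (N x) (x / mu) @[x --> +oo] --> (1 - xi (c * Num.sqrt mu))^-1.
Proof.
move=> mu0 N1 ec nz.
apply: (cvg_trans (near_eq_cvg (erlangCE_near mu0 N1))).
by apply: cvgV => //; have [] := erlang_moderate_cvg mu0 N1 ec.
Qed.

(** * Bounds on [1 / C] for fixed [N] and [r] *)

Lemma erlangC_inv_overload (R : realType) (N : nat) (r : R) : 0 < r -> (0 < N)%N ->
  N%:R < r ->
  r / (4 * ((r - N%:R) ^+ 2 + r)) <=
    1 - (r - N%:R) / N%:R * (erlangBinv N r - 1) <= r / ((r - N%:R) ^+ 2 + r).
Proof.
move=> r0 N0 Nr; have N1 : 0 < N%:R :> R by rewrite ltr0n.
have p : 0 < (r - N%:R) ^+ 2 + r by have := sqr_ge0 (r - N%:R); lra.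
apply/andP; split.
- have := erlangBinv_le r0 Nr; rewrite -ler_pdivrMl //; lra.
- have := erlangBinv_ge r0 (ltW Nr).
  have h : 0 < (r - N%:R) / N%:R by rewrite divr_gt0 // subr_gt0.
  rewrite -(ler_pM2l h).
  suff -> : (r - N%:R) / N%:R * (N%:R * (r - N%:R) / ((r - N%:R) ^+ 2 + r)) =
    1 - r / ((r - N%:R) ^+ 2 + r) by lra.
  by field; rewrite !gt_eqF.
Qed.

Lemma erlangC_inv_underload (R : realType) (N : nat) (r : R) : 0 < r -> (0 < N)%N ->
  r <= N%:R ->
  1 + (N%:R - r) ^+ 2 / N%:R <= 1 - (r - N%:R) / N%:R * (erlangBinv N r - 1).
Proof.
move=> r0 N0 rN; have N1 : 0 < N%:R :> R by rewrite ltr0n.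
rewrite lerD2l -mulNr -mulNr opprB expr2 mulrAC ler_wpM2l //.
  by rewrite divr_ge0 ?subr_ge0.
exact: erlangBinv_ge_slack.
Qed.

(** * The five regimes *)

Theorem theorem1 (R : realType) (mu : R) (N : R -> nat)
  (mu_gt0 : 0 < mu)
  (N_ge1 : forall lambda : R, 0 < lambda -> (1 <= N lambda)%N) :
  let rho : R -> R := fun lambda => lambda / mu in
  let C : R -> R := fun lambda => erlangC (N lambda) (rho lambda) in
  let excess : R -> R := fun lambda => rho lambda - (N lambda)%:R in
  let slack : R -> R := fun lambda => (N lambda)%:R - rho lambda in
  let scaled : R -> R := fun lambda => excess lambda / Num.sqrt (N lambda)%:R in
  let z : R := lim (scaled lambda @[lambda --> +oo]) in
  [/\ eventually_pos excess -> in_omega excess Num.sqrt ->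
        C lambda @[lambda --> +oo] --> +oo,
      eventually_pos excess -> in_Theta excess Num.sqrt ->
        [/\ cvg (scaled lambda @[lambda --> +oo]),
            1 < (1 - xi z)^-1
          & C lambda @[lambda --> +oo] --> (1 - xi z)^-1],
      in_o (fun lambda => `|slack lambda|) Num.sqrt ->
        cvg (scaled lambda @[lambda --> +oo]) /\
        C lambda @[lambda --> +oo] --> (1 : R),
      eventually_pos slack -> in_Theta slack Num.sqrt ->
        [/\ cvg (scaled lambda @[lambda --> +oo]),
            0 < (1 - xi z)^-1 < 1
          & C lambda @[lambda --> +oo] --> (1 - xi z)^-1]
    & eventually_pos slack -> in_omega slack Num.sqrt ->
        C lambda @[lambda --> +oo] --> (0 : R)].
Proof.
move=> rho C excess slack scaled z.
have N0 := near_nat_gt0 N_ge1.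
have x0 : \forall x \near +oo, 0 < x :> R by exact: nbhs_pinfty_gt.
pose D x := 1 - excess x / (N x)%:R * (erlangBinv (N x) (rho x) - 1).
have CE : \forall x \near +oo, (D x)^-1 = C x := erlangCE_near mu_gt0 N_ge1.
have sV : (Num.sqrt x)^-1 @[x --> +oo] --> (0 : R).
  apply/gtr0_cvgV0; last exact: sqrtr_cvgy.
  by near=> x; rewrite sqrtr_gt0; near: x.
(* Common part of the three middle regimes; each of them still has to show that [1 - xi z] is
   nonzero. *)
have moderate (c : R) : excess x / Num.sqrt x @[x --> +oo] --> c ->
  [/\ cvg (scaled x @[x --> +oo]), z = c * Num.sqrt mu,
      scaled x @[x --> +oo] --> z, D x @[x --> +oo] --> 1 - xi z &
      1 - xi z != 0 -> C x @[x --> +oo] --> (1 - xi z)^-1].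
  move=> ec; have [sc Dc] := erlang_moderate_cvg mu_gt0 N_ge1 ec.
  have zE : z = c * Num.sqrt mu by exact: cvg_lim.
  rewrite zE; split => //; first by apply/cvg_ex; exists (c * Num.sqrt mu).
  exact: erlangC_moderate_cvg.
(* For [x > 0] this is [excess ^+ 2 / rho], so that [rho / (excess ^+ 2 + rho) = 1 / (A + 1)]; its
   limit is readable from [excess / sqrt x]. *)
pose A x := (excess x / Num.sqrt x) ^+ 2 * mu.
have overload : eventually_pos excess -> \forall x \near +oo,
    (4 * (A x + 1))^-1 <= D x <= (A x + 1)^-1.
  move=> epos; near=> x; have x_gt0 : 0 < x by near: x.
  have e_gt0 : 0 < excess x by near: x.
  have r_gt0 : 0 < rho x by rewrite divr_gt0.
  have p : 0 < excess x ^+ 2 + rho x by rewrite addr_gt0 ?exprn_gt0.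
  have AE : A x + 1 = (excess x ^+ 2 + rho x) / rho x.
    rewrite /A expr_div_n sqr_sqrtr ?ltW // mulrDl divff ?gt_eqF //.
    by rewrite /rho invf_div mulrA mulrAC.
  rewrite AE mulrA !invf_div; apply: erlangC_inv_overload => //; first exact: N_ge1.
  by rewrite -subr_gt0.
have underload : eventually_pos slack -> \forall x \near +oo,
    1 + slack x ^+ 2 / (N x)%:R <= D x.
  move=> spos; near=> x; have x_gt0 : 0 < x by near: x.
  apply: erlangC_inv_underload; rewrite ?divr_gt0 ?N_ge1 //.
  by rewrite -subr_ge0 ltW //; near: x.
split.
- move=> epos [_ _ oe].
  have B := overload epos.
  apply: (cvg_trans (near_eq_cvg CE)); apply/cvgrVy.
    near=> x; apply: (@lt_le_trans _ _ (4 * (A x + 1))^-1).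
      by rewrite invr_gt0 mulr_gt0 // ltr_wpDl // mulr_ge0 ?sqr_ge0 // ltW.
    by have /andP[] : (4 * (A x + 1))^-1 <= D x <= (A x + 1)^-1 by near: x.
  (* This is [1 / A], which bounds [D] from above; [D] being eventually positive, its inverse tends
     to [+oo]. *)
  have c0 : (Num.sqrt x / excess x) ^+ 2 / mu @[x --> +oo] --> (0 : R).
    have -> : 0 = 0 * 0 / mu :> R by rewrite !mul0r.
    by apply: cvgMl; exact: cvgM.
  apply: (squeeze_cvgr _ (@cvg_cst _ _ _ _ _) c0); near=> x.
  have x_gt0 : 0 < x by near: x.
  have e_gt0 : 0 < excess x by near: x.
  have A_gt0 : 0 < A x by rewrite mulr_gt0 // exprn_gt0 // divr_gt0 // sqrtr_gt0.
  have /andP[B1 B2] : (4 * (A x + 1))^-1 <= D x <= (A x + 1)^-1 by near: x.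
  apply/andP; split.
    by apply: le_trans B1; rewrite invr_ge0 mulr_ge0 // addr_ge0 // ltW.
  have -> : (Num.sqrt x / excess x) ^+ 2 / mu = (A x)^-1.
    by rewrite /A invfM -exprVn invf_div.
  rewrite (le_trans B2) // lef_pV2 ?posrE ?addr_gt0 //.
  by rewrite lerDl.
- move=> epos [_ _ [c c0 ec]].
  have ec' : excess x / Num.sqrt x @[x --> +oo] --> c.
    apply: cvg_trans ec; apply: near_eq_cvg; near=> x.
    by rewrite ger0_norm // divr_ge0 // ltW //; near: x.
  have [cs zE sz Dz Cz] := moderate c ec'.
  have z0 : 0 < z by rewrite zE mulr_gt0 ?sqrtr_gt0.
  have Az : A x + 1 @[x --> +oo] --> z ^+ 2 + 1.
    rewrite zE exprMn sqr_sqrtr ?ltW //.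
    by apply: cvgD; [apply: cvgMl; exact: cvgM|exact: cvg_cst].
  have z1 : 1 < z ^+ 2 + 1 by rewrite ltrDr exprn_gt0.
  have B := overload epos.
  (* [A] tends to [z ^+ 2]. The lower bound makes [1 - xi z] positive; the upper one, with [z > 0],
     puts it below 1. *)
  have lo : (4 * (z ^+ 2 + 1))^-1 <= 1 - xi z.
    have A4 : (4 * (A x + 1))^-1 @[x --> +oo] --> (4 * (z ^+ 2 + 1))^-1.
      apply: cvgV; first by rewrite gt_eqF //; lra.
      by apply: cvgM => //; exact: cvg_cst.
    apply: (ler_cvg_to A4 Dz).
    by apply: filterS B => x /andP[].
  have hi : 1 - xi z <= (z ^+ 2 + 1)^-1.
    have A1 : (A x + 1)^-1 @[x --> +oo] --> (z ^+ 2 + 1)^-1.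
      by apply: cvgV => //; rewrite gt_eqF //; lra.
    apply: (ler_cvg_to Dz A1).
    by apply: filterS B => x /andP[].
  have xi_gt0 : 0 < 1 - xi z by apply: lt_le_trans lo; rewrite invr_gt0; lra.
  split => //; last by apply: Cz; rewrite gt_eqF.
  rewrite invf_gt1 // (le_lt_trans hi) // invf_lt1 //; lra.
- move=> [_ _ oe].
  have ec : excess x / Num.sqrt x @[x --> +oo] --> (0 : R).
    apply/norm_cvg0P; apply: cvg_trans oe; apply: near_eq_cvg; near=> x.
    by rewrite normrM normfV (ger0_norm (sqrtr_ge0 _)) distrC.
  have [cs zE sz Dz Cz] := moderate 0 ec.
  have xi0 : 1 - xi z = 1 by rewrite zE mul0r /xi mul0r subr0.
  by split => //; move: Cz; rewrite xi0 invr1; apply; exact: oner_neq0.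
- move=> spos [_ _ [c c0 ec]].
  have ec' : excess x / Num.sqrt x @[x --> +oo] --> - c.
    apply: cvg_trans (cvgN ec); apply: near_eq_cvg; near=> x.
    rewrite -[LHS]/(- `|slack x / Num.sqrt x|) ger0_norm; last first.
      by rewrite divr_ge0 // ltW //; near: x.
    by rewrite -mulNr opprB.
  have [cs zE sz Dz Cz] := moderate (- c) ec'.
  have z0 : z < 0 by rewrite zE mulNr oppr_lt0 mulr_gt0 ?sqrtr_gt0.
  have B := underload spos.
  (* [slack ^+ 2 / N] is the square of [scaled], hence tends to [z * z], which is positive as
     [z < 0]. *)
  have lo : 1 + z * z <= 1 - xi z.
    apply: (ler_cvg_to (cvgD (@cvg_cst _ _ _ _ _) (cvgM sz sz)) Dz).
    apply: filterS B => x; rewrite (_ : slack x ^+ 2 / _ = scaled x * scaled x) //.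
    by rewrite /scaled mulf_div -!expr2 sqr_sqrtr // -sqrrN opprB.
  have zz : 0 < z * z by rewrite nmulr_rgt0.
  split => //; last by apply: Cz; rewrite gt_eqF //; lra.
  by rewrite invr_gt0 invf_lt1; lra.
- move=> spos [_ _ oe].
  have B := underload spos.
  apply: (cvg_trans (near_eq_cvg CE)).
  (* This is the bound [N / slack ^+ 2] on [C]. As [N] may grow faster than [x], it is split through
     [N = slack + rho] into [1 / slack] and [rho / slack ^+ 2]. *)
  have c0 : Num.sqrt x / slack x * (Num.sqrt x)^-1 +
      (Num.sqrt x / slack x) ^+ 2 / mu @[x --> +oo] --> (0 : R).
    have -> : 0 = 0 * 0 + 0 * 0 / mu :> R by rewrite !mul0r addr0.
    by apply: cvgD; [exact: cvgM|apply: cvgMl; exact: cvgM].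
  apply: (squeeze_cvgr _ (@cvg_cst _ _ _ _ _) c0); near=> x.
  have x_gt0 : 0 < x by near: x.
  have d_gt0 : 0 < slack x by near: x.
  have N_gt0 : 0 < (N x)%:R :> R by rewrite ltr0n N_ge1.
  have Dx : 1 + slack x ^+ 2 / (N x)%:R <= D x by near: x.
  have dN : 0 < slack x ^+ 2 / (N x)%:R by rewrite divr_gt0 // exprn_gt0.
  rewrite invr_ge0; apply/andP; split; first lra.
  have -> : Num.sqrt x / slack x * (Num.sqrt x)^-1 + (Num.sqrt x / slack x) ^+ 2 / mu =
      (slack x ^+ 2 / (N x)%:R)^-1.
    rewrite expr_div_n sqr_sqrtr ?ltW // mulrAC divff ?gt_eqF ?sqrtr_gt0 // mul1r.
    have -> : (N x)%:R = slack x + x / mu by rewrite /slack subrK.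
    rewrite invf_div.
    by field; rewrite !gt_eqF.
  by rewrite lef_pV2 ?posrE; lra.
Unshelve. all: by end_near. Qed.
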